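(* Let $\beta\equiv\beta^{(4)}$ be a normalized nc sequence with a moment matrix $\mathcal M_2$ of rank 5 satisfying the column relations $\mathbb X\mathbb Y+\mathbb Y\mathbb X=\mathbf 0$ and $\mathbb Y^2=\mathbf 1$. Then $\beta$ admits a nc measure exactly in the following cases: (1) $\mathcal M_2$ is positive semidefinite and $\beta_{X^3}=\beta_Y=0$. In this case the minimal measure is unique (up to orthogonal equivalence) and of type $(2,1)$. (2) $\mathcal M_2$ is positive semidefinite and $$\beta_{X^3}=0,\qquad\beta_{X^2}>0,\qquad0<|\beta_Y|<1,\qquad\beta_{X^4}\ge\frac{\beta_{X^2}^2}{1-|\beta_Y|}.$$ In this case the minimal measure is unique (up to orthogonal equivalence); it is of type $(1,1)$ if and only if $\beta_{X^4}=\frac{\beta_{X^2}^2}{1-|\beta_Y|}$, and otherwise it is of type $(2,1)$.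
   Context: Words are elements of the free monoid on noncommuting letters $X,Y$; $|w|$ is the length of $w$, $w^*$ its reverse, and $v,w$ are cyclically equivalent if $v$ is a cyclic permutation of $w$. A sequence $\beta\equiv\beta^{(4)}=(\beta_w)_{|w|\le4}$ is a family of real numbers with $\beta_v=\beta_w$ for cyclically equivalent $v,w$ and $\beta_w=\beta_{w^*}$. It is normalized if $\beta_1=1$, and a nc sequence if $\beta_{X^2Y^2}\ne\beta_{XYXY}$. Its moment matrix $\mathcal M_2$ is the symmetric $7\times7$ matrix with rows and columns indexed by $1,X,Y,X^2,XY,YX,Y^2$ and $(U,V)$ entry $\beta_{U^*V}$; the column indexed by $w$ is denoted $w(\mathbb X,\mathbb Y)$, $\mathbf 1$ is the column indexed by the empty word, and ''satisfies a relation'' means that the corresponding linear relation between columns holds. A representing measure for $\beta$ consists of finitely many pairs $(A_i,B_i)$ (atoms) of real symmetric $t_i\times t_i$ matrices ($t_i$ is the size) and numbers $\lambda_i>0$ (densities) with $\sum_i\lambda_i=1$ and $\beta_w=\sum_i\lambda_i\mathrm{Tr}(w(A_i,B_i))$ for all $|w|\le4$, where $\mathrm{Tr}(A)=\frac1t\mathrm{tr}(A)$ for $A\in\mathbb R^{t\times t}$. It is of type $(m_1,\dots,m_r)$ if it has exactly $m_i$ atoms of size $i$ and $m_r\neq0$. It is minimal if no other representing measure has smaller type, where types are compared first by $r$, then by $m_r$, then $m_{r-1}$, ..., then $m_1$. $\beta$ admits a nc measure if it has a minimal representing measure of type $(m_1,\dots,m_r)$ with $r>1$. Orthogonal equivalence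 means replacing atoms $(A,B)$ by $(UAU^t,UBU^t)$ with $U$ orthogonal. *)

(* Defs.v *)
From HB Require Import structures.
From mathcomp Require Import all_boot all_order all_algebra.
From mathcomp Require Import reals.
Set Implicit Arguments.
Unset Strict Implicit.
Unset Printing Implicit Defensive.
Import Order.TTheory GRing.Theory Num.Theory.
Local Open Scope ring_scope.

(* The letters X and Y are encoded as the two booleans, so that words inherit *)
(* a decidable equality.                                                      *)
Notation letter := bool (only parsing).
Notation word := (seq letter) (only parsing).
Definition lX : letter := false.
Definition lY : letter := true.

Definition cyclically_equivalent (v w : word) : Prop := exists k, v = rot k w.

Section Sequences.
Variable R : realType.
Implicit Types beta : word -> R.

(* A truncated sequence of degree 4 is a function on all words, of which only *)
(* the values at words of length at most 4 are ever constrained or used.      *)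
Definition tracial_sequence4 beta : Prop :=
  (forall v w : word, (size v <= 4)%N -> (size w <= 4)%N ->
     cyclically_equivalent v w -> beta v = beta w) /\
  (forall w : word, (size w <= 4)%N -> beta w = beta (rev w)).

Definition normalized beta : Prop := beta [::] = 1.

Definition nc_sequence beta : Prop :=
  tracial_sequence4 beta /\ beta [:: lX; lX; lY; lY] <> beta [:: lX; lY; lX; lY].

Definition index_words : 7.-tuple word :=
  [tuple [::]; [:: lX]; [:: lY];
         [:: lX; lX]; [:: lX; lY]; [:: lY; lX]; [:: lY; lY]].

Definition moment_matrix beta : 'M[R]_7 :=
  \matrix_(i, j) beta (rev (tnth index_words i) ++ tnth index_words j).

(* Meaningful only for w in index_words. *)
Definition moment_col beta (w : word) : 'cV[R]_7 :=
  col (inord (index w index_words)) (moment_matrix beta).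

Definition psdmx n (M : 'M[R]_n) : Prop :=
  M^T = M /\ forall v : 'cV[R]_n, 0 <= (v^T *m M *m v) 0 0.

End Sequences.

Record atom (R : realType) := Atom {
  atom_size : nat;
  atomX : 'M[R]_atom_size;
  atomY : 'M[R]_atom_size }.

Record finite_measure (R : realType) := FiniteMeasure {
  natoms : nat;
  atoms : 'I_natoms -> atom R;
  density : 'I_natoms -> R }.

Arguments atoms {R} _ _.
Arguments density {R} _ _.

Section Measures.
Variable R : realType.
Implicit Types (a b : atom R) (mu nu : finite_measure R) (beta : word -> R).

Definition is_atom a : Prop :=
  [/\ (0 < atom_size a)%N, (atomX a)^T = atomX a & (atomY a)^T = atomY a].

Definition eval_word a (w : word) : 'M[R]_(atom_size a) :=
  \prod_(l <- w) (if l == lX then atomX a else atomY a).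

Definition normalized_trace n (M : 'M[R]_n) : R := \tr M / n%:R.

Definition representing_measure beta mu : Prop :=
  [/\ forall i, is_atom (atoms mu i),
      forall i, 0 < density mu i,
      \sum_i density mu i = 1 &
      forall w : word, (size w <= 4)%N ->
        beta w = \sum_i density mu i * normalized_trace (eval_word (atoms mu i) w)].

(* [:: m_1; ...; m_r], with r the largest size of an atom, so that m_r != 0. *)
Definition measure_type mu : seq nat :=
  mkseq (fun k => #|[set i | atom_size (atoms mu i) == k.+1]|)
        (\max_i atom_size (atoms mu i))%N.

(* Lexicographic comparison of (r, m_r, m_(r-1), ..., m_1). *)
Definition type_lt (s t : seq nat) : bool :=
  ((size s :: rev s : seqlexi nat) < (size t :: rev t : seqlexi nat))%O.

Definition minimal_measure beta mu : Prop :=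
  representing_measure beta mu /\
  forall nu, representing_measure beta nu ->
    ~~ type_lt (measure_type nu) (measure_type mu).

Definition admits_nc_measure beta : Prop :=
  exists2 mu, minimal_measure beta mu & (1 < size (measure_type mu))%N.

Definition atom_orth_equiv a b : Prop :=
  exists U : 'M[R]_(atom_size a), U *m U^T = 1%:M /\
    b = Atom (U *m atomX a *m U^T) (U *m atomY a *m U^T).

(* Up to the order of the atoms. *)
Definition measure_orth_equiv mu nu : Prop :=
  exists f : 'I_(natoms mu) -> 'I_(natoms nu), bijective f /\
    forall i, density nu (f i) = density mu i /\
              atom_orth_equiv (atoms mu i) (atoms nu (f i)).

Definition unique_minimal_measure beta : Prop :=
  exists2 mu, minimal_measure beta mu &
    forall nu, minimal_measure beta nu -> measure_orth_equiv mu nu.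

End Measures.

(* Main.v *)
Require Import Defs.
From mathcomp Require Import all_boot all_order all_algebra.
From mathcomp Require Import reals.
From mathcomp Require Import perm.
From mathcomp Require Import ring lra.
Import Order.TTheory GRing.Theory Num.Theory.
Local Open Scope ring_scope.
Set Implicit Arguments.
Unset Strict Implicit.
Unset Printing Implicit Defensive.

(* A measure representing beta is supported on atoms satisfying XY + YX = 0 and
   Y^2 = 1, because the traces of the squares of these two relations are moments
   that vanish. Under the relations, the moments of degree at most 4 are determined
   by y, a, c, d, the moments of Y, X^2, X^3, X^4. An atom of size 1 is (0, 1) or
   (0, -1), an atom of size 2 with X <> 0 is orthogonally equivalent to
   X = alpha [[0, 1], [1, 0]], Y = diag (1, -1), and c = 0 because X^3 anticommutes
   with Y. Since the nc hypothesis says a <> 0, a single atom of size 2 is the least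
   one can hope for; then alpha^2 = d / a, its density is a^2 / d, and the remaining
   mass s = 1 - a^2 / d has to be split between (0, 1) and (0, -1) with signed
   total y. This is possible iff |y| <= s, with only one of the two points in use
   iff |y| = s. The inequality is necessary for atoms of any size by Cauchy-Schwarz,
   applied to X^2 and a projection (1 - e Y) / 2. *)

(** * Evaluation of words, normalized traces, and positivity of moment matrices *)

Section WordEvaluation.
Variable R : realType.
Implicit Types (a b : atom R) (mu nu : finite_measure R) (beta gamma : word -> R).

Lemma eval_word_cat a (u v : word) :
  eval_word a (u ++ v) = eval_word a u *m eval_word a v.
Proof. by rewrite /eval_word big_cat. Qed.

Lemma eval_word_cons a l (w : word) :
  eval_word a (l :: w) = (if l == lX then atomX a else atomY a) *m eval_word a w.
Proof. by rewrite -[l :: w]cat1s eval_word_cat {1}/eval_word big_seq1. Qed.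

Lemma eval_word_consX a (w : word) : eval_word a (lX :: w) = atomX a *m eval_word a w.
Proof. by rewrite eval_word_cons. Qed.

Lemma eval_word_consY a (w : word) : eval_word a (lY :: w) = atomY a *m eval_word a w.
Proof. by rewrite eval_word_cons. Qed.

Lemma eval_word_nil a : eval_word a [::] = 1%:M.
Proof. by rewrite /eval_word big_nil. Qed.

Lemma eval_word_rev a (w : word) :
  is_atom a -> eval_word a (rev w) = (eval_word a w)^T.
Proof.
case=> _ symX symY; elim: w => [|l w IHw].
  by rewrite /eval_word !big_nil trmx1.
rewrite rev_cons -cats1 eval_word_cat IHw -[l :: w]cat1s eval_word_cat.
by rewrite trmx_mul {2 4}/eval_word !big_seq1; case: ifP => _; rewrite ?symX ?symY.
Qed.

Lemma normalized_trace0 n : normalized_trace (0 : 'M[R]_n) = 0.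
Proof. by rewrite /normalized_trace raddf0 mul0r. Qed.

Lemma normalized_traceD n (M N : 'M[R]_n) :
  normalized_trace (M + N) = normalized_trace M + normalized_trace N.
Proof. by rewrite /normalized_trace raddfD mulrDl. Qed.

Lemma normalized_traceB n (M N : 'M[R]_n) :
  normalized_trace (M - N) = normalized_trace M - normalized_trace N.
Proof. by rewrite /normalized_trace raddfB mulrBl. Qed.

Lemma normalized_traceC n (M N : 'M[R]_n) :
  normalized_trace (M *m N) = normalized_trace (N *m M).
Proof. by rewrite /normalized_trace mxtrace_mulC. Qed.

Lemma normalized_trace_tr n (M : 'M[R]_n) :
  normalized_trace M^T = normalized_trace M.
Proof. by rewrite /normalized_trace mxtrace_tr. Qed.

Lemma normalized_trace_scalar n (c : R) :
  (0 < n)%N -> normalized_trace (c%:M : 'M[R]_n) = c.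
Proof.
move=> n_gt0; rewrite /normalized_trace mxtrace_scalar -[c *+ n]mulr_natr mulfK //.
by rewrite pnatr_eq0 -lt0n.
Qed.

Lemma mxtrace_sqr m n (C : 'M[R]_(m, n)) :
  \tr (C^T *m C) = \sum_i \sum_j C j i ^+ 2.
Proof.
by apply: eq_bigr => i _; rewrite mxE; apply: eq_bigr => j _; rewrite mxE expr2.
Qed.

Lemma normalized_trace_sqr_ge0 m n (C : 'M[R]_(m, n)) :
  0 <= normalized_trace (C^T *m C).
Proof.
rewrite divr_ge0 ?ler0n // mxtrace_sqr.
by do 2![apply: sumr_ge0 => ? _]; rewrite sqr_ge0.
Qed.

Lemma normalized_trace_sqr_eq0 n (C : 'M[R]_n) :
  normalized_trace (C^T *m C) = 0 -> C = 0.
Proof.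
(* Size 0 is treated apart: there the normalizing factor is the default inverse of 0, but the empty
   matrix is 0 anyway. *)
case: n C => [|n] C; first by rewrite [C]flatmx0.
move/eqP; rewrite mulf_eq0 invr_eq0 pnatr_eq0 orbF mxtrace_sqr.
rewrite psumr_eq0 => [/allP C0|i _]; last by apply: sumr_ge0 => j _; apply: sqr_ge0.
apply/matrixP => j i; rewrite mxE; have := C0 i (mem_index_enum i).
rewrite /= psumr_eq0 => [/allP /(_ j (mem_index_enum j))|k _]; last exact: sqr_ge0.
by rewrite sqrf_eq0 => /eqP.
Qed.

Definition moment mu (w : word) : R :=
  \sum_i density mu i * normalized_trace (eval_word (atoms mu i) w).

Lemma moment_rot mu k w : moment mu (rot k w) = moment mu w.
Proof.
apply: eq_bigr => i _; congr (_ * _).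
by rewrite -{2}(cat_take_drop k w) /rot !eval_word_cat normalized_traceC.
Qed.

Lemma moment_tracial mu :
  (forall i, is_atom (atoms mu i)) -> tracial_sequence4 (moment mu).
Proof.
move=> at_mu; split=> [v w _ _ [k ->]|w _]; first exact: moment_rot.
by apply: eq_bigr => i _; rewrite eval_word_rev // normalized_trace_tr.
Qed.

Lemma index_words_size (u : word) : u \in index_words -> (size u <= 2)%N.
Proof.
by rewrite /index_words /= !inE => /or4P[|||/or4P[]] /eqP->.
Qed.

(** A vector v is read as a polynomial of degree at most 2. Its value of the quadratic form is the
    average over the atoms of the trace of [(C k)^T *m C k], where [C k] is the polynomial evaluated
    at the atom. *)
Lemma psdmx_moment_matrix beta mu :
  representing_measure beta mu -> psdmx (moment_matrix beta).
Proof.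
case=> at_mu dens_gt0 _ rep.
have idx i : (size (tnth index_words i) <= 2)%N.
  by apply: index_words_size; rewrite mem_tnth.
have sz i j : (size (rev (tnth index_words i) ++ tnth index_words j) <= 4)%N.
  by rewrite size_cat size_rev; exact: (leq_add (idx i) (idx j)).
have entry i j : moment_matrix beta i j = \sum_k density mu k * normalized_trace
    ((eval_word (atoms mu k) (tnth index_words i))^T *m
     eval_word (atoms mu k) (tnth index_words j)).
  rewrite mxE rep //; apply: eq_bigr => k _.
  by rewrite eval_word_cat eval_word_rev.
split.
  apply/matrixP => i j; rewrite mxE !entry; apply: eq_bigr => k _.
  by rewrite -normalized_trace_tr trmx_mul trmxK.
move=> v; pose C k : 'M_(atom_size (atoms mu k)) :=
  \sum_i v i 0 *: eval_word (atoms mu k) (tnth index_words i).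
suff -> : (v^T *m moment_matrix beta *m v) 0 0 =
    \sum_k density mu k * normalized_trace ((C k)^T *m C k).
  by apply: sumr_ge0 => k _; rewrite mulr_ge0 ?normalized_trace_sqr_ge0 ?ltW.
have expand k : normalized_trace ((C k)^T *m C k) = \sum_i \sum_j
    v i 0 * v j 0 * normalized_trace
     ((eval_word (atoms mu k) (tnth index_words i))^T *m
      eval_word (atoms mu k) (tnth index_words j)).
  have -> : (C k)^T = \sum_i v i 0 *: (eval_word (atoms mu k) (tnth index_words i))^T.
    by rewrite linear_sum; apply: eq_bigr => i _; rewrite linearZ.
  rewrite mulmx_suml /normalized_trace linear_sum /= mulr_suml.
  apply: eq_bigr => i _; rewrite mulmx_sumr linear_sum /= mulr_suml.
  apply: eq_bigr => j _.
  by rewrite -scalemxAr -scalemxAl scalerA mxtraceZ mulrA [v j 0 * _]mulrC.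
under [RHS]eq_bigr do rewrite expand mulr_sumr.
rewrite exchange_big mxE /= [RHS](eq_bigr (fun i => \sum_j v i 0 * v j 0 * moment_matrix beta i j)).
  rewrite exchange_big /=; apply: eq_bigr => j _; rewrite mxE mulr_suml.
  by apply: eq_bigr => i _; rewrite mxE; ring.
move=> i _; under eq_bigr do rewrite mulr_sumr.
rewrite exchange_big /=; apply: eq_bigr => j _.
by rewrite entry mulr_sumr; apply: eq_bigr => k _; ring.
Qed.

End WordEvaluation.

(** * Column relations: the moments they determine and the atoms they force *)

Section ColumnRelations.
Variable R : realType.
Implicit Types (a b : atom R) (mu nu : finite_measure R) (beta gamma : word -> R).

(** The two column relations row by row, free of matrix indices, so that they can be checked for
    [moment mu] as well. *)
Definition relation_moments beta : Prop :=
  forall u : word, u \in index_words ->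
    beta (rev u ++ [:: lX; lY]) + beta (rev u ++ [:: lY; lX]) = 0 /\
    beta (rev u ++ [:: lY; lY]) = beta (rev u).

Lemma moment_colE beta (u w : word) :
  u \in index_words -> w \in index_words ->
  moment_col beta w (inord (index u index_words)) 0 = beta (rev u ++ w).
Proof.
move=> uI wI; rewrite !mxE !(tnth_nth [::]).
have idx (v : word) : v \in index_words ->
    (inord (index v index_words) : 'I_7) = index v index_words :> nat.
  by move=> vI; rewrite inordK //; move: vI; rewrite -index_mem size_tuple.
by rewrite !idx // !nth_index.
Qed.

Lemma relation_moments_of_cols beta :
  moment_col beta [:: lX; lY] + moment_col beta [:: lY; lX] = 0 ->
  moment_col beta [:: lY; lY] = moment_col beta [::] ->
  relation_moments beta.
Proof.
move=> hXY hYY u uI; split.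
  have /matrixP /(_ (inord (index u index_words)) 0) := hXY.
  by rewrite mxE !moment_colE // mxE.
by rewrite -moment_colE // hYY moment_colE // cats0.
Qed.

(** One representative of each cyclic class of words of length at most 4. *)
Definition cyclic_words : seq word :=
  [:: [::]; [:: lX]; [:: lY]; [:: lX; lX]; [:: lX; lY]; [:: lY; lY];
      [:: lX; lX; lX]; [:: lX; lX; lY]; [:: lX; lY; lY]; [:: lY; lY; lY];
      [:: lX; lX; lX; lX]; [:: lX; lX; lX; lY]; [:: lX; lX; lY; lY];
      [:: lX; lY; lX; lY]; [:: lX; lY; lY; lY]; [:: lY; lY; lY; lY]].

Lemma cyclic_words_cover (w : word) : (size w <= 4)%N ->
  exists2 v, v \in cyclic_words & cyclically_equivalent w v.
Proof.
move=> sz; suff /hasP[v vI /hasP[k _ /eqP wE]] :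
    has (fun v => has (fun k => w == rot k v) (iota 0 4)) cyclic_words.
  by exists v => //; exists k.
by case: w sz => [|[] [|[] [|[] [|[] [|? ?]]]]].
Qed.

Lemma cyclic_words_size (w : word) : w \in cyclic_words -> (size w <= 4)%N.
Proof. by apply/allP: w. Qed.

(** The rows of the relations and rotation invariance form a linear system in the moments. For
    instance, the row of Y gives 2 beta(XYY) = 0, and the row of X turns this into beta(X) = 0. *)
Lemma relation_moments_values beta :
  tracial_sequence4 beta -> relation_moments beta -> normalized beta ->
  [/\ [/\ beta [:: lX] = 0, beta [:: lX; lY] = 0, beta [:: lY; lY] = 1,
          beta [:: lX; lX; lY] = 0 & beta [:: lX; lY; lY] = 0],
      [/\ beta [:: lY; lY; lY] = beta [:: lY], beta [:: lX; lX; lX; lY] = 0 &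
          beta [:: lX; lX; lY; lY] = beta [:: lX; lX]] &
      [/\ beta [:: lX; lY; lX; lY] = - beta [:: lX; lX],
          beta [:: lX; lY; lY; lY] = 0 & beta [:: lY; lY; lY; lY] = 1]].
Proof.
move=> [cyc _] rel b1.
have rot_eq k w : (size w <= 4)%N -> beta (rot k w) = beta w.
  by move=> sz; apply: cyc; rewrite ?size_rot //; exists k.
have /= [e1 e2] := rel [::] isT; have /= [e3 e4] := rel [:: lX] isT.
have /= [e5 e6] := rel [:: lY] isT; have /= [e7 e8] := rel [:: lX; lX] isT.
have /= [e9 e10] := rel [:: lX; lY] isT; have /= [e11 e12] := rel [:: lY; lY] isT.
rewrite /rev /= in e1 e2 e3 e4 e5 e6 e7 e8 e9 e10 e11 e12.
have /= r1 := rot_eq 1%N [:: lX; lY] isT.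
have /= r2 := rot_eq 1%N [:: lX; lX; lY] isT.
have /= r3 := rot_eq 1%N [:: lX; lY; lY] isT.
have /= r4 := rot_eq 2%N [:: lX; lY; lY] isT.
have /= r5 := rot_eq 1%N [:: lX; lX; lX; lY] isT.
have /= r6 := rot_eq 2%N [:: lX; lX; lX; lY] isT.
have /= r7 := rot_eq 3%N [:: lX; lX; lY; lY] isT.
have /= r8 := rot_eq 1%N [:: lX; lY; lX; lY] isT.
have /= r9 := rot_eq 2%N [:: lX; lY; lY; lY] isT.
have /= r10 := rot_eq 3%N [:: lX; lY; lY; lY] isT.
rewrite /rot /= in r1 r2 r3 r4 r5 r6 r7 r8 r9 r10.
rewrite /normalized in b1.
split; split; lra.
Qed.

(** Reduces the verification that a measure represents [beta] to the four moments left free by the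
    relations. *)
Lemma relation_moments_eq beta gamma :
  tracial_sequence4 beta -> relation_moments beta -> normalized beta ->
  tracial_sequence4 gamma -> relation_moments gamma -> normalized gamma ->
  {in [:: [:: lY]; [:: lX; lX]; [:: lX; lX; lX]; [:: lX; lX; lX; lX]], beta =1 gamma} ->
  forall w : word, (size w <= 4)%N -> beta w = gamma w.
Proof.
move=> bt br b1 gt gr g1 eq_free w sz.
have [v vI wv] := cyclic_words_cover sz; have szv := cyclic_words_size vI.
rewrite (bt.1 _ _ sz szv wv) (gt.1 _ _ sz szv wv) => {w sz wv szv}.
have [[? ? ? ? ?] [? ? ?] [? ? ?]] := relation_moments_values bt br b1.
have [[? ? ? ? ?] [? ? ?] [? ? ?]] := relation_moments_values gt gr g1.
have := eq_free [:: lY] isT; have := eq_free [:: lX; lX] isT.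
have := eq_free [:: lX; lX; lX] isT; have := eq_free [:: lX; lX; lX; lX] isT.
move=> ? ? ? ?; rewrite /normalized in b1 g1.
suff /allP /(_ v vI) /eqP : all (fun v => beta v == gamma v) cyclic_words by [].
by do ![apply/andP; split; first by apply/eqP; congruence].
Qed.

Definition satisfies_relations a : Prop :=
  atomX a *m atomY a + atomY a *m atomX a = 0 /\ atomY a *m atomY a = 1%:M.

Lemma moment_relations mu :
  (forall i, satisfies_relations (atoms mu i)) -> relation_moments (moment mu).
Proof.
move=> rel u _; split.
  rewrite /moment -big_split big1 // => i _ /=.
  rewrite -mulrDr -normalized_traceD !eval_word_cat -mulmxDr.
  rewrite /eval_word !big_cons !big_nil /= !mulr1.
  by rewrite (rel i).1 mulmx0 normalized_trace0 mulr0.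
apply: eq_bigr => i _; rewrite eval_word_cat /eval_word !big_cons !big_nil /= mulr1.
by rewrite -[_ * _ in X in _ *m X]/(_ *m _) (rel i).2 mulmx1.
Qed.

Lemma representing_relations beta mu :
  tracial_sequence4 beta -> relation_moments beta -> normalized beta ->
  representing_measure beta mu -> forall i, satisfies_relations (atoms mu i).
Proof.
move=> bt br b1 [at_mu dens_gt0 dens1 rep] i.
(* A zero sum of nonnegative terms with positive densities vanishes termwise. *)
have vanish (C : forall k, 'M[R]_(atom_size (atoms mu k))) :
    \sum_k density mu k * normalized_trace ((C k)^T *m C k) = 0 -> C i = 0.
  move/eqP; rewrite psumr_eq0 => [/allP /(_ i (mem_index_enum i)) /=|k _].
    by rewrite mulf_eq0 gt_eqF //= => /eqP /normalized_trace_sqr_eq0.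
  by rewrite mulr_ge0 ?normalized_trace_sqr_ge0 ?ltW.
have [[_ _ yy _ _] [_ _ xxyy] [xyxy _ yyyy]] := relation_moments_values bt br b1.
split.
- apply: (vanish (fun k => atomX (atoms mu k) *m atomY (atoms mu k) +
                           atomY (atoms mu k) *m atomX (atoms mu k))).
  have rot_eq k w : (size w <= 4)%N -> beta (rot k w) = beta w.
    by move=> sz; apply: bt.1; rewrite ?size_rot //; exists k.
  (* These are the four words in the expansion of (XY + YX)^2. Up to rotation their moments add up
     to 2 beta(XXYY) + 2 beta(XYXY) = 0. *)
  transitivity (beta [:: lY; lX; lX; lY] + beta [:: lY; lX; lY; lX] +
               (beta [:: lX; lY; lX; lY] + beta [:: lX; lY; lY; lX])).
    rewrite !rep // -!big_split /=; apply: eq_bigr => k _.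
    have [_ symX symY] := at_mu k.
    rewrite -!mulrDr -!normalized_traceD [(_ + _)^T]linearD /= !trmx_mul symX symY.
    by rewrite mulmxDl !mulmxDr !eval_word_cons !eval_word_nil /= !mulmx1 !mulmxA.
  have := rot_eq 3%N [:: lX; lX; lY; lY] isT; have := rot_eq 1%N [:: lX; lX; lY; lY] isT.
  have := rot_eq 1%N [:: lX; lY; lX; lY] isT; rewrite /rot /= => -> -> ->.
  by rewrite xxyy xyxy; ring.
- apply/eqP; rewrite -subr_eq0; apply/eqP.
  apply: (vanish (fun k => atomY (atoms mu k) *m atomY (atoms mu k) - 1%:M)).
  (* The expansion of (Y^2 - 1)^2, with value 1 - 2 + 1 = 0. *)
  transitivity (beta [:: lY; lY; lY; lY] - 2 * beta [:: lY; lY] + beta [::]).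
    rewrite !rep // mulr_sumr -sumrB -big_split /=; apply: eq_bigr => k _.
    have [_ symX symY] := at_mu k.
    rewrite [(_ - _)^T]linearB /= !trmx_mul symY trmx1 mulmxBl !mulmxBr.
    rewrite !eval_word_cons !eval_word_nil /= !mulmx1 !mul1mx.
    by rewrite !normalized_traceB !mulmxA; ring.
  by rewrite yyyy yy b1; ring.
Qed.

End ColumnRelations.

(** * Traces for an anticommuting pair whose second member is an involution *)

Section AnticommutingPair.
Variables (R : realType) (n : nat) (A B : 'M[R]_n).
Hypotheses (symA : A^T = A) (symB : B^T = B).
Hypotheses (anti : A *m B + B *m A = 0) (invol : B *m B = 1%:M).

Lemma mxtrace_anticomm (M N : 'M[R]_n) : M *m N = - (N *m M) -> \tr (M *m N) = 0.
Proof. by move=> /(congr1 mxtrace); rewrite raddfN /= (mxtrace_mulC N); lra. Qed.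

Let mulBA : B *m A = - (A *m B).
Proof. by apply/eqP; rewrite -addr_eq0 addrC anti. Qed.

Lemma anticomm_sqr : A *m A *m B = B *m (A *m A).
Proof. by rewrite mulmxA mulBA mulNmx -[A *m B *m A]mulmxA mulBA mulmxN opprK mulmxA. Qed.

(** A is the product of AB and B, which anticommute, so cyclicity of the trace gives tr A = - tr A.
    The cube below is split in the same way, into A^3 B and B. *)
Lemma anticomm_mxtrace : \tr A = 0.
Proof.
rewrite -[A]mulmx1 -invol mulmxA; apply: mxtrace_anticomm.
by rewrite mulmxA mulBA mulNmx opprK.
Qed.

Lemma anticomm_mxtrace_cube : \tr (A *m A *m A) = 0.
Proof.
rewrite -[A *m A *m A]mulmx1 -invol mulmxA; apply: mxtrace_anticomm.
rewrite -mulmxA invol mulmx1 !mulmxA -[B *m A *m A]mulmxA -anticomm_sqr.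
by rewrite -[_ *m B *m A]mulmxA mulBA mulmxN mulNmx opprK !mulmxA -!mulmxA invol !mulmx1.
Qed.

Lemma anticomm_mxtrace_sqr_mul : \tr (A *m A *m B) = 0.
Proof.
rewrite -mulmxA; apply: mxtrace_anticomm.
by rewrite -[A *m B *m A]mulmxA mulBA mulmxN opprK.
Qed.

Lemma anticomm_mxtrace_quad_mul : \tr (A *m A *m (A *m A) *m B) = 0.
Proof.
rewrite -!mulmxA; apply: mxtrace_anticomm.
by rewrite -!mulmxA mulBA !mulmxN opprK.
Qed.

(* The trace of the square of [(1 - e B) (A^2 + t)], where [(1 - e B)^2 = 2 (1 - e B)]
   and [tr (A^2 B) = tr (A^4 B) = 0]. *)
Lemma anticomm_mxtrace_ge0 (e t : R) : e ^+ 2 = 1 ->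
  0 <= \tr (A *m A *m (A *m A)) + 2 * t * \tr (A *m A) + t ^+ 2 * (n%:R - e * \tr B).
Proof.
move=> e2; pose P := 1%:M - e *: B; pose Q := A *m A + t%:M.
have symP : P^T = P by rewrite [LHS]linearB /= linearZ /= trmx1 symB.
have symQ : Q^T = Q by rewrite [LHS]linearD /= trmx_mul symA tr_scalar_mx.
have P2 : P *m P = 2 *: P.
  rewrite /P mulmxBl mul1mx mulmxBr mulmx1 -scalemxAl -scalemxAr.
  by rewrite invol scalerA -expr2 e2 scale1r scaler_nat mulr2n opprB addrA.
have PQ : Q *m P = P *m Q.
  rewrite /P /Q mulmxBr mulmxBl mulmx1 mul1mx -scalemxAr -scalemxAl; congr (_ - _ *: _).
  by rewrite mulmxDl mulmxDr anticomm_sqr scalar_mxC.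
have : 0 <= \tr ((P *m Q)^T *m (P *m Q)).
  rewrite mxtrace_sqr; do 2![apply: sumr_ge0 => ? _]; exact: sqr_ge0.
rewrite trmx_mul symP symQ PQ mxtrace_mulC.
have -> : P *m Q *m (P *m Q) = 2 *: (Q *m Q *m P).
  by rewrite -{1}PQ -[LHS]mulmxA [P *m (P *m Q)]mulmxA P2 -scalemxAl -scalemxAr -PQ mulmxA.
rewrite mxtraceZ pmulr_rge0 ?ltr0n //.
have -> : Q *m Q = A *m A *m (A *m A) + (2 * t) *: (A *m A) + (t ^+ 2)%:M.
  rewrite /Q mulmxDl !mulmxDr mul_scalar_mx mul_mx_scalar -scalar_mxM expr2.
  by rewrite mulrDl mul1r scalerDl !addrA.
rewrite mulmxBr mulmx1 -scalemxAr !mulmxDl -scalemxAl mul_scalar_mx.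
rewrite !(raddfB, raddfD, mxtraceZ) /= !(mxtraceD, mxtraceZ) mxtrace_scalar.
rewrite anticomm_mxtrace_sqr_mul anticomm_mxtrace_quad_mul -mulr_natr.
move=> H; apply: le_trans H _; rewrite le_eqVlt; apply/orP; left; apply/eqP; ring.
Qed.

End AnticommutingPair.

(** * Classification of the atoms of sizes 1 and 2 *)

Section SmallAtoms.
Variable R : realType.
Implicit Types (a b : atom R).

Definition point_atom (e : R) : atom R := @Atom R 1 0 e%:M.

(** The size is written [1 + 1] so that block matrices of scalars can be used. *)
Definition double_atom (alpha : R) : atom R :=
  @Atom R (1 + 1) (block_mx 0 alpha%:M alpha%:M 0) (block_mx 1%:M 0 0 (-1)%:M).

Lemma is_atom_point e : is_atom (point_atom e).
Proof. by split; rewrite //= ?trmx0 ?tr_scalar_mx. Qed.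

Lemma is_atom_double alpha : is_atom (double_atom alpha).
Proof. by split; rewrite //= tr_block_mx ?trmx0 ?tr_scalar_mx. Qed.

Lemma point_atom_relations e : e ^+ 2 = 1 -> satisfies_relations (point_atom e).
Proof.
by move=> e2; split; rewrite /= ?mul0mx ?mulmx0 ?addr0 // -scalar_mxM -expr2 e2.
Qed.

Lemma double_atom_relations alpha : satisfies_relations (double_atom alpha).
Proof.
split; rewrite /= !mulmx_block !(mulmx0, mul0mx, mulmx1, mul1mx, addr0, add0r) -!scalar_mxM.
  by rewrite add_block_mx !(mulN1r, mulrN1) !raddfN /= subrr addNr !addr0 block_mx0.
by rewrite mulrNN mulr1 -scalar_mx_block.
Qed.

Lemma double_atom_sqr alpha :
  atomX (double_atom alpha) *m atomX (double_atom alpha) = (alpha ^+ 2)%:M.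
Proof.
by rewrite /= mulmx_block !(mulmx0, mul0mx, addr0, add0r) -scalar_mxM -scalar_mx_block expr2.
Qed.

Lemma double_atom_mxtraceY alpha : \tr (atomY (double_atom alpha)) = 0.
Proof. by rewrite /= mxtrace_block !mxtrace_scalar mulr1n addrN. Qed.

(** For scalars the relations read 2xy = 0 and y^2 = 1, hence x = 0. *)
Lemma size1_atom a :
  satisfies_relations a -> atom_size a = 1%N ->
  exists2 e, e ^+ 2 = 1 & a = point_atom e.
Proof.
case: a => n X Y [/= anti invol] n1; move: X Y anti invol; rewrite n1 => X Y.
rewrite [X]mx11_scalar [Y]mx11_scalar -!scalar_mxM -raddfD => /matrixP /(_ 0 0).
rewrite !mxE /= !mulr1n => anti /matrixP /(_ 0 0); rewrite !mxE /= !mulr1n => invol.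
exists (Y 0 0); first by rewrite expr2.
have Y0 : Y 0 0 != 0 by apply: contra_eq_neq invol => ->; rewrite mulr0 eq_sym oner_eq0.
suff -> : X 0 0 = 0 by rewrite raddf0.
by apply: (mulIf Y0); rewrite mul0r; lra.
Qed.

(** By Cayley-Hamilton the square of a traceless matrix of size 2 is scalar; taking traces
    identifies the scalar. *)
Lemma size2_sqr_scalar (A : 'M[R]_2) :
  A^T = A -> \tr A = 0 -> A *m A = (\tr (A *m A) / 2)%:M.
Proof.
move=> /matrixP symA; have := symA 0 (lift 0 0); rewrite mxE => A10.
rewrite /mxtrace !big_ord_recl !big_ord0 !mxE !big_ord_recl !big_ord0 A10 => trA.
have {trA} A11 : A (lift 0 0) (lift 0 0) = - A 0 0 by move: trA; rewrite /=; lra.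
apply/matrixP => i j; rewrite !mxE !big_ord_recl !big_ord0 A11.
by case: (unliftP 0 i) => [i'|] ->; case: (unliftP 0 j) => [j'|] ->;
  rewrite ?ord1 /= ?A10 ?A11 ?mulr1n ?mulr0n; field.
Qed.

(* In the basis [u], [alpha^-1 X u], where [u] is a unit vector fixed by [Y], the
   pair [(X, Y)] becomes [double_atom alpha]. *)
Lemma size2_atom a :
  is_atom a -> satisfies_relations a -> atom_size a = 2%N ->
  normalized_trace (atomX a *m atomX a) != 0 ->
  atom_orth_equiv (double_atom (Num.sqrt (normalized_trace (atomX a *m atomX a)))) a.
Proof.
case: a => n X Y [_ /= symX symY] [/= anti invol] n2.
move: X Y symX symY anti invol; rewrite n2 => X Y symX symY anti invol.
have X2 := size2_sqr_scalar symX (anticomm_mxtrace anti invol).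
set s := normalized_trace _ => s0.
have s_ge0 : 0 <= s by rewrite /s -{1}symX normalized_trace_sqr_ge0.
pose alpha := Num.sqrt s; have alpha2 : alpha ^+ 2 = s by rewrite sqr_sqrtr.
have alpha0 : alpha != 0 by rewrite -sqrf_eq0 alpha2.
rewrite -[_ / 2]/s -alpha2 in X2; rewrite -/alpha.
have mulYX : Y *m X = - (X *m Y) by apply/eqP; rewrite -addr_eq0 addrC anti.
have [u Yu uu] : exists2 u : 'cV_2, Y *m u = u & u^T *m u = 1%:M.
  (* Since Y^2 = 1, every column of 1 + Y is fixed by Y. If all of them vanished, then Y = -1, and
     anticommutation would force X = 0. *)
  have [j uj] : exists j, col j (1%:M + Y) != 0.
    apply/existsP; apply: contraNT s0; rewrite negb_exists => /forallP all0.
    have Y1 : Y = - 1%:M.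
      apply/eqP; rewrite -addr_eq0 addrC; apply/eqP/matrixP => i j.
      by have := all0 j; rewrite negbK => /eqP /matrixP /(_ i 0); rewrite !mxE.
    suff X0 : X = 0 by rewrite /s X0 mul0mx normalized_trace0.
    move: anti; rewrite Y1 mulmxN mulNmx mulmx1 mul1mx => /matrixP anti.
    by apply/matrixP => i j; have := anti i j; rewrite !mxE; lra.
  pose v := col j (1%:M + Y); pose N := (v^T *m v) 0 0.
  have vv : v^T *m v = N%:M by rewrite [LHS]mx11_scalar.
  have N_gt0 : 0 < N.
    have Nsum : N = \sum_i v i 0 ^+ 2.
      by rewrite /N mxE; apply: eq_bigr => i _; rewrite mxE expr2.
    rewrite lt0r {2}Nsum sumr_ge0 ?andbT => [|i _]; last exact: sqr_ge0.
    apply: contra uj; rewrite Nsum psumr_eq0 => [/allP v0|i _]; last exact: sqr_ge0.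
    apply/eqP/matrixP => i k; rewrite ord1 [RHS]mxE.
    by have := v0 i (mem_index_enum i); rewrite /= sqrf_eq0 => /eqP.
  exists ((Num.sqrt N)^-1 *: v).
    rewrite -scalemxAr; congr (_ *: _).
    by rewrite /v colE mulmxA mulmxDr mulmx1 invol addrC.
  rewrite [(_ *: _)^T]linearZ /= -scalemxAl -scalemxAr scalerA vv scale_scalar_mx.
  by rewrite -invfM -expr2 sqr_sqrtr ?ltW // mulVf ?gt_eqF.
pose w := alpha^-1 *: (X *m u); pose U : 'M_(2, 1 + 1) := row_mx u w.
have Xu : X *m u = alpha *: w by rewrite scalerA divff ?scale1r.
have Xw : X *m w = alpha *: u.
  rewrite -scalemxAr mulmxA X2 mul_scalar_mx scalerA; congr (_ *: _).
  by rewrite expr2 mulKf.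
have Yw : Y *m w = - w.
  by rewrite -scalemxAr mulmxA mulYX mulNmx -mulmxA Yu scalerN.
have ww : w^T *m w = 1%:M.
  rewrite {1}/w [(_ *: _)^T]linearZ /= trmx_mul symX -scalemxAl -mulmxA Xw -scalemxAr uu.
  by rewrite scalerA mulVf // scale1r.
(* Eigenvectors of the symmetric Y for the distinct eigenvalues 1 and -1. *)
have uw : u^T *m w = 0.
  have : u^T *m w = - (u^T *m w).
    by rewrite -{1}Yu trmx_mul symY -mulmxA Yw mulmxN.
  by move=> /matrixP uw; apply/matrixP => i j; have := uw i j; rewrite !mxE; lra.
have wu : w^T *m u = 0 by rewrite -[u]trmxK -trmx_mul uw trmx0.
have UU : U^T *m U = 1%:M.
  by rewrite tr_row_mx mul_col_row uu uw wu ww -scalar_mx_block.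
have {}UU : U *m U^T = 1%:M := mulmx1C UU.
exists U; split=> //=; congr Atom.
- have <- : X *m U = U *m block_mx 0 alpha%:M alpha%:M 0.
    by rewrite mul_mx_row mul_row_block !mulmx0 !mul_mx_scalar add0r addr0 Xu Xw.
  by rewrite -mulmxA UU mulmx1.
- have <- : Y *m U = U *m block_mx 1%:M 0 0 (-1)%:M.
    rewrite mul_mx_row mul_row_block !mulmx0 mulmx1 mul_mx_scalar add0r addr0 Yu Yw.
    by rewrite scaleN1r.
  by rewrite -mulmxA UU mulmx1.
Qed.

End SmallAtoms.

(** * Moments of the small atoms and their orthogonal invariance *)

Section AtomMoments.
Variable R : realType.
Implicit Types (a b : atom R).

Lemma atom_orth_equiv_refl a : atom_orth_equiv a a.
Proof.
exists 1%:M; rewrite trmx1 !mulmx1 !mul1mx; split=> //.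
by case: a.
Qed.

Lemma atom_orth_equiv_moment a b (w : word) : atom_orth_equiv a b ->
  normalized_trace (eval_word b w) = normalized_trace (eval_word a w).
Proof.
move=> [U [UU ->]]; have {UU} UU := mulmx1C UU.
set b' := Atom _ _.
suff -> : eval_word b' w = U *m eval_word a w *m U^T.
  by rewrite normalized_traceC mulmxA UU mul1mx.
elim: w => [|l w IHw]; first by rewrite !eval_word_nil mulmx1 mulmx1C.
rewrite !eval_word_cons IHw; case: ifP => _ /=;
  by rewrite !mulmxA -[_ *m U^T *m U]mulmxA UU mulmx1.
Qed.

Lemma point_atom_momentX (e : R) (w : word) :
  normalized_trace (eval_word (point_atom e) (lX :: w)) = 0.
Proof. by rewrite eval_word_consX mul0mx normalized_trace0. Qed.

Lemma point_atom_momentY (e : R) : normalized_trace (eval_word (point_atom e) [:: lY]) = e.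
Proof. by rewrite eval_word_consY eval_word_nil mulmx1 normalized_trace_scalar. Qed.

Lemma double_atom_moments (alpha : R)
    (m := fun w : word => normalized_trace (eval_word (double_atom alpha) w)) :
  [/\ m [:: lY] = 0, m [:: lX; lX] = alpha ^+ 2, m [:: lX; lX; lX] = 0 &
      m [:: lX; lX; lX; lX] = alpha ^+ 2 ^+ 2].
Proof.
have [anti invol] := double_atom_relations alpha.
rewrite /m !(eval_word_consX, eval_word_consY, eval_word_nil) !mulmx1.
split.
- by rewrite /normalized_trace double_atom_mxtraceY mul0r.
- by rewrite double_atom_sqr normalized_trace_scalar.
- by rewrite mulmxA /normalized_trace (anticomm_mxtrace_cube anti invol) mul0r.
- by rewrite !mulmxA -mulmxA double_atom_sqr -scalar_mxM normalized_trace_scalar.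
Qed.

End AtomMoments.

(** * Measures with one atom of size 2 and points, and the order on types *)

Section MeasureTypes.
Variable R : realType.
Implicit Types (mu nu : finite_measure R).

Lemma measure_type_pair nu p q : measure_type nu = [:: p; q] ->
  [/\ forall i, (atom_size (atoms nu i) <= 2)%N,
      #|[set i | atom_size (atoms nu i) == 1%N]| = p &
      #|[set i | atom_size (atoms nu i) == 2%N]| = q].
Proof.
rewrite /measure_type => tE; have max2 := congr1 size tE; rewrite size_mkseq /= in max2.
rewrite max2 in tE; case: tE => <- <-; split=> // i.
by rewrite -max2 (leq_bigmax i).
Qed.

(** Puts the only atom of size 2 at [ord_max] and the points before it, which is the layout of
    [canonical_measure]. *)
Lemma measure_type_enum nu m : (forall i, (0 < atom_size (atoms nu i))%N) ->
  measure_type nu = [:: m; 1%N] ->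
  exists f : 'I_m.+1 -> 'I_(natoms nu),
    [/\ bijective f, forall j, atom_size (atoms nu (f (lift ord_max j))) = 1%N &
        atom_size (atoms nu (f ord_max)) = 2%N].
Proof.
move=> size_gt0 /measure_type_pair[size_le2]; set S1 := [set _ | _].
move=> cardS1 /eqP /cards1P[k /setP S2E].
have sizek : atom_size (atoms nu k) = 2%N.
  by have := S2E k; rewrite !inE eqxx => /eqP.
have sizeS i : (i \in S1) || (i == k).
  have := S2E i; rewrite !inE => <-.
  by have := size_le2 i; have := size_gt0 i; case: atom_size => [|[|[]]].
pose s := rcons (enum S1) k.
have s_uniq : uniq s by rewrite rcons_uniq enum_uniq mem_enum inE sizek.
have sz : size (enum S1) = m by rewrite -cardE.
pose f (j : 'I_m.+1) := nth k s j; exists f; split.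
- apply: inj_card_bij => [i j /eqP|].
    by rewrite nth_uniq ?size_rcons ?sz // => /eqP /val_inj.
  (* Injectivity is enough once there are at most m + 1 atoms, and this holds because every index
     occurs in [s]. *)
  rewrite [X in (_ <= X)%N]card_ord -sz -(size_rcons _ k) -/s cardE.
  rewrite uniq_leq_size ?enum_uniq // => i _.
  by rewrite mem_rcons inE mem_enum orbC.
- move=> j; rewrite /f lift_max nth_rcons sz ltn_ord.
  by have : nth k (enum S1) j \in enum S1; [rewrite mem_nth ?sz|rewrite mem_enum inE => /eqP].
- by rewrite /f nth_rcons sz ltnn eqxx.
Qed.

(** An atom of size at least 2 keeps r from dropping below 2, so a smaller type has r = 2. Then m_2
    is positive and at most 1, and only the number of points can decrease. *)
Lemma type_lt_pair nu m : (exists i, 1 < atom_size (atoms nu i))%N ->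
  type_lt (measure_type nu) [:: m; 1%N] ->
  exists2 p, (p < m)%N & measure_type nu = [:: p; 1%N].
Proof.
move=> [i i_gt1]; rewrite /type_lt.
have : (1 < size (measure_type nu))%N.
  by rewrite size_mkseq (leq_trans i_gt1) // (leq_bigmax i).
case tE : (measure_type nu) => [//|p [//|q [|r t]]] _; last first.
  by rewrite Order.SeqLexiOrder.ltEseqlexi.
move=> lt_t; have [size_le2 _ cardq] := measure_type_pair tE.
have q_gt0 : (0 < q)%N.
  rewrite -cardq; apply/card_gt0P; exists i.
  by rewrite inE eqn_leq size_le2.
move: lt_t; rewrite /= !Order.SeqLexiOrder.ltEseqlexi /rev /= => /andP[q_le1].
rewrite leEnat q_gt0 /= Order.SeqLexiOrder.ltEseqlexi => /andP[p_le].
rewrite Order.SeqLexiOrder.ltEseqlexi implybF leEnat -ltnNge => p_lt.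
by exists p; rewrite // (@anti_leq q 1) // q_gt0 andbT.
Qed.

Lemma type_lt_total (s t : seq nat) : ~~ type_lt s t -> ~~ type_lt t s -> s = t.
Proof.
rewrite /type_lt -!leNgt => le_ts le_st.
have [_ /(congr1 rev)] : size s :: rev s = size t :: rev t.
  by apply: (@le_anti _ (seqlexi nat)); rewrite le_st.
by rewrite !revK.
Qed.

End MeasureTypes.

(** * The model measures: one [double_atom] together with m points *)

Section CanonicalMeasure.
Variable R : realType.
Implicit Types (mu nu : finite_measure R).

Definition canonical_measure m (rho e : 'I_m -> R) (lambda alpha : R) : finite_measure R :=
  @FiniteMeasure R m.+1
    (fun i => if unlift ord_max i is Some j then point_atom (e j) else double_atom alpha)
    (fun i => if unlift ord_max i is Some j then rho j else lambda).

Lemma unlift_lift_max m (j : 'I_m) : unlift ord_max (lift ord_max j) = Some j.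
Proof. exact: liftK. Qed.

Lemma measure_type_canonical m (rho e : 'I_m -> R) lambda alpha :
  measure_type (canonical_measure rho e lambda alpha) = [:: m; 1%N].
Proof.
rewrite /measure_type (bigD1_ord ord_max) //= unlift_none /=.
rewrite (maxn_idPl _); last by apply/bigmax_leqP => j _; rewrite /= unlift_lift_max.
rewrite -[(1 + 1)%N]/2%N /mkseq /=; congr [:: _; _].
  rewrite -[RHS]/(m.+1.-1) -[m.+1 in RHS]card_ord -(cardsC1 ord_max).
  apply: eq_card => i; rewrite !inE.
  by case: (unliftP ord_max i) => [j|] ->; rewrite ?unlift_lift_max ?unlift_none ?eqxx ?lift_eqF.
rewrite -[RHS](cards1 (@ord_max m)); apply: eq_card => i; rewrite !inE.
by  case: (unliftP ord_max i) => [j|] ->; rewrite ?unlift_lift_max ?unlift_none ?eqxx ?lift_eqF.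
Qed.

Lemma moment_canonical m (rho e : 'I_m -> R) lambda alpha w :
  moment (canonical_measure rho e lambda alpha) w =
    lambda * normalized_trace (eval_word (double_atom alpha) w) +
    \sum_j rho j * normalized_trace (eval_word (point_atom (e j)) w).
Proof.
rewrite /moment (bigD1_ord ord_max) //= unlift_none; congr (_ + _).
by apply: eq_bigr => j _; rewrite unlift_lift_max.
Qed.

(** Conjugation is trivial in size 1, so the points are asked to agree exactly and only the atom of
    size 2 up to equivalence. *)
Lemma canonical_orth_equiv m (rho e : 'I_m -> R) lambda alpha nu
    (f : 'I_m.+1 -> 'I_(natoms nu)) : bijective f ->
  (forall j, density nu (f (lift ord_max j)) = rho j) ->
  (forall j, atoms nu (f (lift ord_max j)) = point_atom (e j)) ->
  density nu (f ord_max) = lambda ->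
  atom_orth_equiv (double_atom alpha) (atoms nu (f ord_max)) ->
  measure_orth_equiv (canonical_measure rho e lambda alpha) nu.
Proof.
move=> f_bij rhoE eE lambdaE equiv; exists f; split=> // i /=.
case: (unliftP ord_max i) => [j|] ->; rewrite ?unlift_lift_max ?unlift_none //.
by split=> //; rewrite eE; apply: atom_orth_equiv_refl.
Qed.

End CanonicalMeasure.

(** * Necessary conditions, and the measures of type (m, 1) *)

Section RelationSequences.
Variables (R : realType) (beta : word -> R).
Hypotheses (bt : tracial_sequence4 beta) (br : relation_moments beta).
Hypotheses (b1 : normalized beta).
Local Notation y := (beta [:: lY]).
Local Notation a := (beta [:: lX; lX]).
Local Notation c := (beta [:: lX; lX; lX]).
Local Notation d := (beta [:: lX; lX; lX; lX]).
Implicit Types (mu nu : finite_measure R).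

Lemma representing_cube mu : representing_measure beta mu -> c = 0.
Proof.
move=> repm; have rel := representing_relations bt br b1 repm.
case: repm => at_mu _ _ rep; rewrite rep // big1 // => i _.
have [anti invol] := rel i.
rewrite !(eval_word_consX, eval_word_nil) mulmx1 mulmxA /normalized_trace.
by rewrite (anticomm_mxtrace_cube anti invol) mul0r mulr0.
Qed.

(** [anticomm_mxtrace_ge0] averaged over the atoms. Keeping t free gives a quadratic polynomial in t
    whose nonnegativity encodes Cauchy-Schwarz. *)
Lemma representing_quadratic mu (e t : R) : representing_measure beta mu ->
  e ^+ 2 = 1 -> 0 <= d + 2 * t * a + t ^+ 2 * (1 - e * y).
Proof.
move=> repm e2; have rel := representing_relations bt br b1 repm.
case: repm => at_mu dens_gt0 dens1 rep.
have -> : d + 2 * t * a + t ^+ 2 * (1 - e * y) = \sum_i density mu i *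
    ((\tr (atomX (atoms mu i) *m atomX (atoms mu i) *m
           (atomX (atoms mu i) *m atomX (atoms mu i)))
      + 2 * t * \tr (atomX (atoms mu i) *m atomX (atoms mu i))
      + t ^+ 2 * ((atom_size (atoms mu i))%:R - e * \tr (atomY (atoms mu i))))
     / (atom_size (atoms mu i))%:R).
  have -> : 1 - e * y = \sum_i density mu i - e * y by rewrite dens1.
  rewrite !rep // !mulr_sumr -sumrB mulr_sumr -!big_split; apply: eq_bigr => i _ /=.
  rewrite !(eval_word_consX, eval_word_consY, eval_word_nil) !mulmx1 !mulmxA /normalized_trace.
  have [/lt0n_neq0 size0 _ _] := at_mu i; field.
  by rewrite pnatr_eq0.
apply: sumr_ge0 => i _; have [_ symX symY] := at_mu i; have [anti invol] := rel i.
apply: mulr_ge0; first exact: ltW.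
rewrite divr_ge0 ?ler0n //; exact: (anticomm_mxtrace_ge0 symX symY anti invol).
Qed.

Lemma representing_bound mu : representing_measure beta mu -> a <> 0 ->
  `|y| < 1 /\ a ^+ 2 / (1 - `|y|) <= d.
Proof.
move=> repm a0; have quad := representing_quadratic _ repm.
have [e e2 ey] : exists2 e : R, e ^+ 2 = 1 & e * y = `|y|.
  case: (ger0P y) => _; first by exists 1; rewrite ?mul1r ?expr1n.
  by exists (-1); rewrite ?mulN1r ?sqrrN ?expr1n.
have {}quad t := quad e t e2; rewrite ey in quad; set s := 1 - `|y| in quad *.
have s_gt0 : 0 < s.
  case: (ltrP 0 s) => // s_le0.
  (* This t makes d + 2ta equal to -1. The term in t^2 is at most 0 when s <= 0, so the total would
     be negative. *)
  have := quad (- (d + 1) / (2 * a)).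
  have -> : 2 * (- (d + 1) / (2 * a)) * a = - (d + 1) by field; apply/eqP.
  have := mulr_ge0_le0 (sqr_ge0 (- (d + 1) / (2 * a))) s_le0; lra.
split; first by move: s_gt0; rewrite /s; lra.
(* The minimizer of the quadratic polynomial, where its value is d - a^2 / s. *)
have := quad (- a / s).
rewrite (_ : _ + _ = d - a ^+ 2 / s); first by rewrite subr_ge0.
by field; rewrite gt_eqF.
Qed.

Lemma representing_sqr_ge0 mu : representing_measure beta mu -> 0 <= a.
Proof.
case=> at_mu dens_gt0 _ rep; rewrite rep //; apply: sumr_ge0 => i _.
have [_ symX _] := at_mu i; apply: mulr_ge0; first exact: ltW.
rewrite !(eval_word_consX, eval_word_nil) mulmx1 -{1}symX.
exact: normalized_trace_sqr_ge0.
Qed.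

(** If all atoms had size 1, then X would be 0 on each of them, and so would the moment of X^2. *)
Lemma representing_size nu : representing_measure beta nu -> a <> 0 ->
  exists i, (1 < atom_size (atoms nu i))%N.
Proof.
move=> repm a0; have rel := representing_relations bt br b1 repm.
case: repm => at_nu _ _ rep; apply/existsP; apply: contra_notT a0.
rewrite negb_exists => /forallP small; rewrite rep // big1 // => i _.
have size1 : atom_size (atoms nu i) = 1%N.
  by have [size_gt0 _ _] := at_nu i; apply/eqP; rewrite eqn_leq size_gt0 leqNgt small.
by have [e _ ->] := size1_atom (rel i) size1; rewrite point_atom_momentX mulr0.
Qed.

(** Points contribute nothing to the moments of X^2 and X^4. With s the normalized trace of X^2 on
    the atom of size 2 and lambda its density, a = lambda s and d = lambda s^2, whence s = d / a and
    lambda = a^2 / d. That atom has trace 0 in Y, so the points carry the whole of y. *)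
Lemma representing_pair nu m : representing_measure beta nu -> a <> 0 ->
  measure_type nu = [:: m; 1%N] ->
  0 < d /\ exists f : 'I_m.+1 -> 'I_(natoms nu), exists e : 'I_m -> R,
    [/\ bijective f,
        forall j, e j ^+ 2 = 1 /\ atoms nu (f (lift ord_max j)) = point_atom (e j),
        atom_orth_equiv (double_atom (Num.sqrt (d / a))) (atoms nu (f ord_max)),
        density nu (f ord_max) = a ^+ 2 / d &
        \sum_j density nu (f (lift ord_max j)) = 1 - a ^+ 2 / d /\
        \sum_j density nu (f (lift ord_max j)) * e j = y].
Proof.
move=> repm a0 type_nu; have rel := representing_relations bt br b1 repm.
have a_ge0 := representing_sqr_ge0 repm.
case: repm => at_nu dens_gt0 dens1 rep.
have [|f [f_bij size1 size2]] := measure_type_enum _ type_nu.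
  by move=> i; have [] := at_nu i.
have /fin_all_exists [e eP] j : exists e : R,
    e ^+ 2 = 1 /\ atoms nu (f (lift ord_max j)) = point_atom e.
  by have [e] := size1_atom (rel _) (size1 j); exists e.
have sumE (F : 'I_(natoms nu) -> R) :
    \sum_i F i = F (f ord_max) + \sum_j F (f (lift ord_max j)).
  by rewrite (reindex f) ?(bigD1_ord ord_max) //; apply: onW_bij.
set k := f ord_max in size2 sumE *; set lambda := density nu k.
have lambda_gt0 : 0 < lambda := dens_gt0 k.
set s := normalized_trace (atomX (atoms nu k) *m atomX (atoms nu k)).
have aE : a = lambda * s.
  rewrite rep // sumE !(eval_word_consX, eval_word_nil) mulmx1 big1 ?addr0 // => j _.
  by rewrite (eP j).2 point_atom_momentX mulr0.
have s_gt0 : 0 < s.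
  rewrite -(pmulr_rgt0 _ lambda_gt0) -aE lt0r a_ge0 andbT; exact/eqP.
have equiv := size2_atom (at_nu k) (rel k) size2 (lt0r_neq0 s_gt0).
rewrite -/s in equiv.
have [mY mXX _ mX4] := double_atom_moments (Num.sqrt s).
have dE : d = lambda * s ^+ 2.
  rewrite rep // sumE big1 ?addr0 => [|j _]; last first.
    by rewrite (eP j).2 point_atom_momentX mulr0.
  by rewrite (atom_orth_equiv_moment _ equiv) mX4 sqr_sqrtr ?ltW.
have yE : \sum_j density nu (f (lift ord_max j)) * e j = y.
  rewrite rep // sumE (atom_orth_equiv_moment _ equiv) mY mulr0 add0r.
  by apply: eq_bigr => j _; rewrite (eP j).2 point_atom_momentY.
have lambdaE : lambda = a ^+ 2 / d.
  by rewrite aE dE; field; rewrite !gt_eqF.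
have sE : s = d / a by rewrite aE dE; field; rewrite !gt_eqF.
split; first by rewrite dE mulr_gt0 ?exprn_gt0.
exists f, e; split=> //; first by rewrite -sE.
split=> //; by rewrite -lambdaE -dens1 sumE addrC addKr.
Qed.

(** The converse of [representing_pair]: the double atom supplies the moments of X^2 and X^4, the
    points supply that of Y, and [relation_moments_eq] takes care of all other words. *)
Lemma representing_canonical m (rho e : 'I_m -> R) :
  0 < a -> c = 0 -> 0 < d -> (forall j, 0 < rho j) -> (forall j, e j ^+ 2 = 1) ->
  \sum_j rho j = 1 - a ^+ 2 / d -> \sum_j rho j * e j = y ->
  representing_measure beta
    (canonical_measure rho e (a ^+ 2 / d) (Num.sqrt (d / a))).
Proof.
move=> a_gt0 c0 d_gt0 rho_gt0 e2 rho_sum e_sum; set mu := canonical_measure _ _ _ _.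
have at_mu i : is_atom (atoms mu i).
  by rewrite /=; case: unlift => [j|]; [apply: is_atom_point|apply: is_atom_double].
have rel i : satisfies_relations (atoms mu i).
  rewrite /=; case: unlift => [j|]; last exact: double_atom_relations.
  exact: point_atom_relations.
have alpha2 : Num.sqrt (d / a) ^+ 2 = d / a by rewrite sqr_sqrtr ?divr_ge0 ?ltW.
have dens1 : \sum_i density mu i = 1.
  rewrite (bigD1_ord ord_max) //= unlift_none.
  by under eq_bigr do rewrite unlift_lift_max; rewrite rho_sum addrC subrK.
have m1 : normalized (moment mu).
  rewrite /normalized -dens1; apply: eq_bigr => i _.
  by rewrite eval_word_nil normalized_trace_scalar ?mulr1 //; have [] := at_mu i.
split=> //.
  move=> i; rewrite /=; case: unlift => [j|]; first exact: rho_gt0.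
  by rewrite divr_gt0 ?exprn_gt0.
apply: (relation_moments_eq bt br b1 (moment_tracial at_mu) (moment_relations rel) m1).
have [mY mXX mXXX mX4] := double_atom_moments (Num.sqrt (d / a)).
have pX w : \sum_j rho j * normalized_trace (eval_word (point_atom (e j)) (lX :: w)) = 0.
  by rewrite big1 // => j _; rewrite point_atom_momentX mulr0.
have ad0 : (a != 0) && (d != 0) by rewrite !gt_eqF.
move=> w; rewrite !inE => /or4P[] /eqP->; rewrite moment_canonical ?pX.
- rewrite mY mulr0 add0r -e_sum; apply: eq_bigr => j _.
  by rewrite point_atom_momentY.
- by rewrite mXX alpha2 addr0; field.
- by rewrite mXXX mulr0 addr0.
- by rewrite mX4 alpha2 addr0; field.
Qed.

(** By [type_lt_pair] the only possible smaller types are [p; 1] with p < m. Types are totally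
    ordered, so all minimal measures share one type. *)
Lemma pair_type_minimal m mu : a <> 0 ->
  representing_measure beta mu -> measure_type mu = [:: m; 1%N] ->
  (forall nu p, (p < m)%N -> representing_measure beta nu ->
     measure_type nu <> [:: p; 1%N]) ->
  minimal_measure beta mu /\
  forall nu, minimal_measure beta nu -> measure_type nu = [:: m; 1%N].
Proof.
move=> a0 rep_mu type_mu no_smaller.
have min_mu : minimal_measure beta mu.
  split=> // nu rep_nu; apply/negP; rewrite type_mu => lt_nu.
  have [p p_lt] := type_lt_pair (representing_size rep_nu a0) lt_nu.
  exact: no_smaller.
split=> // nu [rep_nu min_nu]; rewrite -type_mu.
by apply: type_lt_total; [apply: min_mu.2|apply: min_nu].
Qed.

End RelationSequences.

(** * Existence and uniqueness of minimal measures *)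

Section MinimalMeasures.
Variables (R : realType) (beta : word -> R).
Hypotheses (bt : tracial_sequence4 beta) (br : relation_moments beta).
Hypotheses (b1 : normalized beta).
Local Notation y := (beta [:: lY]).
Local Notation a := (beta [:: lX; lX]).
Local Notation c := (beta [:: lX; lX; lX]).
Local Notation d := (beta [:: lX; lX; lX; lX]).
Implicit Types (mu nu : finite_measure R).

Lemma minimal_measure_boundary :
  0 < a -> c = 0 -> 0 < `|y| < 1 -> d = a ^+ 2 / (1 - `|y|) ->
  exists2 mu, minimal_measure beta mu & forall nu, minimal_measure beta nu ->
    measure_type nu = [:: 1; 1]%N /\ measure_orth_equiv mu nu.
Proof.
move=> a_gt0 c0 /andP[y_gt0 y_lt1] dE; have a0 : a <> 0 by apply/eqP; rewrite gt_eqF.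
have s_gt0 : 0 < 1 - `|y| by rewrite subr_gt0.
have d_gt0 : 0 < d by rewrite dE divr_gt0 ?exprn_gt0.
have sE : 1 - a ^+ 2 / d = `|y|.
  by rewrite dE; field; rewrite !gt_eqF.
have y0 : y != 0 by rewrite -normr_gt0.
(* The mass left by the atom of size 2 is exactly |y|, so a single point with the sign of y produces
   the moment y. *)
pose rho (_ : 'I_1) : R := `|y|; pose e (_ : 'I_1) := Num.sg y.
have rep_mu : representing_measure beta
    (canonical_measure rho e (a ^+ 2 / d) (Num.sqrt (d / a))).
  apply: representing_canonical => //; rewrite ?big_ord1 //.
    by move=> j; rewrite sqr_sg y0.
  by rewrite mulrC -numEsg.
have [nu p|min_mu type_min] :=
    pair_type_minimal bt br b1 a0 rep_mu (measure_type_canonical _ _ _ _).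
  (* With no points at all, the leftover mass |y| > 0 would have to be 0. *)
  rewrite ltnS leqn0 => /eqP -> rep_nu type_nu.
  have [_ [f [e' [_ _ _ _ [+ _]]]]] := representing_pair bt br b1 rep_nu a0 type_nu.
  by rewrite big_ord0 sE => /eqP; rewrite eq_sym gt_eqF.
exists (canonical_measure rho e (a ^+ 2 / d) (Num.sqrt (d / a))) => // nu min_nu.
have type_nu := type_min nu min_nu; split=> //.
have [_ [f [e' [f_bij eE equiv lambdaE []]]]] :=
  representing_pair bt br b1 min_nu.1 a0 type_nu.
rewrite !big_ord1 sE => rhoE e'E.
apply: (canonical_orth_equiv f_bij) => // j; rewrite ord1 //.
rewrite (eE _).2; congr point_atom; apply: (mulfI (lt0r_neq0 y_gt0)).
by rewrite -{1}rhoE e'E mulrC -numEsg.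
Qed.

Lemma minimal_measure_interior :
  0 < a -> c = 0 -> `|y| < 1 -> a ^+ 2 / (1 - `|y|) < d ->
  exists2 mu, minimal_measure beta mu & forall nu, minimal_measure beta nu ->
    measure_type nu = [:: 2; 1]%N /\ measure_orth_equiv mu nu.
Proof.
move=> a_gt0 c0 y_lt1 d_gt; have a0 : a <> 0 by apply/eqP; rewrite gt_eqF.
have s_gt0 : 0 < 1 - `|y| by rewrite subr_gt0.
have d_gt0 : 0 < d by apply: lt_trans d_gt; rewrite divr_gt0 ?exprn_gt0.
pose s := 1 - a ^+ 2 / d.
have s_gt : `|y| < s.
  by rewrite /s ltrBrDr addrC -ltrBrDr ltr_pdivrMr // mulrC -ltr_pdivrMr.
have [s_gt_y s_gt_Ny] : y < s /\ - y < s by move: s_gt; rewrite ltr_norml; lra.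
(* The solution of rho_0 + rho_1 = s and rho_0 - rho_1 = y, positive because |y| < s. *)
pose rho (j : 'I_2) : R := if j == ord0 then (s + y) / 2 else (s - y) / 2.
pose e (j : 'I_2) : R := if j == ord0 then 1 else -1.
have rep_mu : representing_measure beta
    (canonical_measure rho e (a ^+ 2 / d) (Num.sqrt (d / a))).
  apply: representing_canonical => //; rewrite ?big_ord_recl ?big_ord0 /rho /e /=.
  - by move=> j; case: ifP => _; lra.
  - by move=> j; case: ifP => _; rewrite ?sqrrN expr1n.
  - by rewrite -/s; field.
  - by field.
have two_signs (e' : R) : e' ^+ 2 = 1 -> e' = 1 \/ e' = -1.
  by move=> /eqP; rewrite sqrf_eq1 => /orP[] /eqP; [left|right].
have [nu [|[|//]] _ rep_nu type_nu|min_mu type_min] :=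
    pair_type_minimal bt br b1 a0 rep_mu (measure_type_canonical _ _ _ _).
(* No point would mean s = 0, and one point would mean y = s or y = -s; both contradict |y| < s. *)
- have [_ [f [e' [_ _ _ _ [+ _]]]]] := representing_pair bt br b1 rep_nu a0 type_nu.
  by rewrite big_ord0 -/s => s0; move: (normr_ge0 y); lra.
- have [_ [f [e' [_ eE _ _ []]]]] := representing_pair bt br b1 rep_nu a0 type_nu.
  rewrite !big_ord1 -/s => ->.
  by have [-> | ->] := two_signs _ (eE ord0).1; lra.
exists (canonical_measure rho e (a ^+ 2 / d) (Num.sqrt (d / a))) => // nu min_nu.
have type_nu := type_min nu min_nu; split=> //.
have [_ [f [e' [f_bij eE equiv lambdaE []]]]] :=
  representing_pair bt br b1 min_nu.1 a0 type_nu.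
rewrite !big_ord_recl !big_ord0 !addr0 -/s.
set j1 : 'I_2 := lift ord0 ord0; set i0 := lift ord_max ord0; set i1 := lift ord_max j1.
have jE (j : 'I_2) : j = ord0 \/ j = j1.
  by case: (unliftP ord0 j) => [k|] ->; [right; rewrite ord1|left].
have [at0 at1] := ((eE ord0).2, (eE j1).2); rewrite -/i0 -/i1 in at0 at1.
(* Equal signs would again give |y| = s. Opposite signs determine the weights, and if the negative
   point comes first, a transposition restores the order. *)
have [e0 | e0] := two_signs _ (eE ord0).1; have [e1 | e1] := two_signs _ (eE j1).1;
  rewrite e0 e1 in at0 at1 *.
- by move=> rho_sum e_sum; exfalso; lra.
- move=> rho_sum e_sum; apply: (canonical_orth_equiv f_bij) => // j.
    by case: (jE j) => ->; rewrite -?/i0 -?/i1 /rho /=; lra.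
  by case: (jE j) => ->.
- move=> rho_sum e_sum; pose g := f \o tperm i0 i1.
  have g_max : g ord_max = f ord_max by rewrite /g /= tpermD.
  have g0 : g i0 = f i1 by rewrite /g /= tpermL.
  have g1 : g i1 = f i0 by rewrite /g /= tpermR.
  apply: (@canonical_orth_equiv _ _ _ _ _ _ _ g); rewrite ?g_max //.
  + exact: bij_comp f_bij (injF_bij perm_inj).
  + by move=> j; case: (jE j) => ->; rewrite -?/i0 -?/i1 ?g0 ?g1 /rho /=; lra.
  + by move=> j; case: (jE j) => ->; rewrite -?/i0 -?/i1 ?g0 ?g1.
- by move=> rho_sum e_sum; exfalso; lra.
Qed.

Lemma psdmx_sqr_ge0 : psdmx (moment_matrix beta) -> 0 <= a.
Proof.
case=> _ /(_ (delta_mx (inord 1) 0)).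
rewrite trmx_delta -rowE -colE !mxE !(tnth_nth [::]) /= inordK //.
Qed.

(* If [d = a^2], the column of [X^2] is [a] times the column of [1], and only four
   independent columns are left. *)
Lemma rank5_quad_gt : psdmx (moment_matrix beta) -> \rank (moment_matrix beta) = 5%N ->
  moment_col beta [:: lX; lY] + moment_col beta [:: lY; lX] = 0 ->
  moment_col beta [:: lY; lY] = moment_col beta [::] ->
  c = 0 -> y = 0 -> a ^+ 2 < d.
Proof.
move=> [_ psdM] rank5 hXY hYY c0 y0; set M := moment_matrix beta in psdM rank5 *.
have [[bX bXY bYY bXXY bXYY] [bYYY bXXXY bXXYY] _] := relation_moments_values bt br b1.
have rot_eq k w : (size w <= 4)%N -> beta (rot k w) = beta w.
  by move=> sz; apply: bt.1; rewrite ?size_rot //; exists k.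
rewrite lt_neqAle; apply/andP; split; last first.
  (* The vector of the polynomial X^2 - a, on which the quadratic form is d - a^2. *)
  have := psdM (delta_mx (inord 3) 0 - a *: delta_mx (inord 0) 0).
  rewrite [(_ - _)^T]linearB /= [(_ *: _)^T]linearZ /= !trmx_delta.
  rewrite !(mulmxBl, mulmxBr) -!scalemxAl -!scalemxAr -!rowE -!colE !mxE.
  rewrite !(tnth_nth [::]) /= !inordK //= /rev /=; move: b1; rewrite /normalized => ->; lra.
apply/eqP => dE.
have colXX i : M i (inord 3) = a * M i (inord 0).
  have /= r1 := rot_eq 1%N [:: lX; lY] isT; have /= r2 := rot_eq 2%N [:: lX; lX; lY] isT.
  have /= r3 := rot_eq 3%N [:: lX; lX; lX; lY] isT.
  have /= r4 := rot_eq 2%N [:: lX; lX; lX; lY] isT.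
  have /= r5 := rot_eq 2%N [:: lX; lX; lY; lY] isT.
  have := b1; rewrite /rot /normalized /= in r1 r2 r3 r4 r5 * => b0.
  rewrite !mxE !(tnth_nth [::]) !inordK //.
  case: i => [[|[|[|[|[|[|[|i]]]]]]] lti] //=;
    rewrite /rev /= ?r1 ?r2 ?r3 ?r4 ?r5 ?b0 ?bXY ?bYY ?bXXY ?bXXXY ?bXXYY ?bX ?y0 ?c0 -?dE;
    ring.
have colYX i : M i (inord 5) = - M i (inord 4).
  by have /matrixP /(_ i 0) := hXY; rewrite !mxE /= => /eqP; rewrite addrC addr_eq0 => /eqP.
have colYY i : M i (inord 6) = M i (inord 0).
  by have /matrixP /(_ i 0) := hYY; rewrite !mxE.
(* [P] keeps the columns of 1, X, Y and XY, and [T] holds the coefficients that express all seven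
   columns through them. *)
pose P : 'M[R]_(7, 4) := \matrix_(i, k) M i (inord (nth 0%N [:: 0; 1; 2; 4]%N k)).
pose T : 'M[R]_(4, 7) := \matrix_(k, j) nth 0 (nth [::]
  [:: [:: 1; 0; 0; a; 0; 0; 1]; [:: 0; 1; 0; 0; 0; 0; 0];
      [:: 0; 0; 1; 0; 0; 0; 0]; [:: 0; 0; 0; 0; 1; -1; 0]] k) j.
suff ME : M = P *m T.
  by have := leq_trans (mxrankM_maxl P T) (rank_leq_col P); rewrite -ME rank5.
apply/matrixP => i j; rewrite [RHS]mxE !big_ord_recl big_ord0 ![P i _]mxE ![T _ _]mxE.
rewrite -(inord_val j); case: j => [[|[|[|[|[|[|[|//]]]]]]] ltj] /=; rewrite inordK //=.
all: rewrite ?colXX ?colYX ?colYY; ring.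
Qed.

End MinimalMeasures.

Theorem theorem6p8 (R : realType) (beta : word -> R)
  (hnorm : normalized beta) (hnc : nc_sequence beta)
  (hrank : \rank (moment_matrix beta) = 5%N)
  (hXY : moment_col beta [:: lX; lY] + moment_col beta [:: lY; lX] = 0)
  (hYY : moment_col beta [:: lY; lY] = moment_col beta [::]) :
  (admits_nc_measure beta <->
     [/\ psdmx (moment_matrix beta),
         beta [:: lX; lX; lX] = 0 & beta [:: lY] = 0] \/
     [/\ psdmx (moment_matrix beta),
         beta [:: lX; lX; lX] = 0,
         0 < beta [:: lX; lX],
         0 < `|beta [:: lY]| < 1 &
         beta [:: lX; lX] ^+ 2 / (1 - `|beta [:: lY]|)
           <= beta [:: lX; lX; lX; lX]])
  /\
  ([/\ psdmx (moment_matrix beta),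
       beta [:: lX; lX; lX] = 0 & beta [:: lY] = 0] ->
     unique_minimal_measure beta /\
     forall mu, minimal_measure beta mu -> measure_type mu = [:: 2; 1]%N)
  /\
  ([/\ psdmx (moment_matrix beta),
       beta [:: lX; lX; lX] = 0,
       0 < beta [:: lX; lX],
       0 < `|beta [:: lY]| < 1 &
       beta [:: lX; lX] ^+ 2 / (1 - `|beta [:: lY]|)
         <= beta [:: lX; lX; lX; lX]] ->
     unique_minimal_measure beta /\
     forall mu, minimal_measure beta mu ->
       (measure_type mu = [:: 1; 1]%N <->
          beta [:: lX; lX; lX; lX]
            = beta [:: lX; lX] ^+ 2 / (1 - `|beta [:: lY]|)) /\
       (beta [:: lX; lX; lX; lX]
            <> beta [:: lX; lX] ^+ 2 / (1 - `|beta [:: lY]|) ->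
          measure_type mu = [:: 2; 1]%N)).

Proof.
have br := relation_moments_of_cols hXY hYY; have bt := hnc.1.
have [_ [_ _ bXXYY] [bXYXY _ _]] := relation_moments_values bt br hnorm.
(* The moments of XXYY and XYXY are a and -a, so they differ only if a is nonzero. *)
have a0 : beta [:: lX; lX] <> 0.
  by move=> a0; apply: hnc.2; rewrite bXXYY bXYXY a0 oppr0.
have case1 : [/\ psdmx (moment_matrix beta), beta [:: lX; lX; lX] = 0 & beta [:: lY] = 0] ->
    exists2 mu, minimal_measure beta mu & forall nu, minimal_measure beta nu ->
      measure_type nu = [:: 2; 1]%N /\ measure_orth_equiv mu nu.
  move=> [psdM c0 y0].
  have a_gt0 : 0 < beta [:: lX; lX].
    by rewrite lt0r psdmx_sqr_ge0 // andbT; apply/eqP.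
  (* Rank 5 makes the bound strict when y = 0, which puts this case in the interior. *)
  have d_gt := rank5_quad_gt bt br hnorm psdM hrank hXY hYY c0 y0.
  by apply: minimal_measure_interior => //; rewrite y0 normr0 ?subr0 ?divr1.
have case2 : [/\ psdmx (moment_matrix beta),
       beta [:: lX; lX; lX] = 0,
       0 < beta [:: lX; lX],
       0 < `|beta [:: lY]| < 1 &
       beta [:: lX; lX] ^+ 2 / (1 - `|beta [:: lY]|)
         <= beta [:: lX; lX; lX; lX]] ->
    exists2 mu, minimal_measure beta mu & forall nu, minimal_measure beta nu ->
      measure_type nu = (if beta [:: lX; lX; lX; lX] ==
        beta [:: lX; lX] ^+ 2 / (1 - `|beta [:: lY]|) then [:: 1; 1]%N else [:: 2; 1]%N)
      /\ measure_orth_equiv mu nu.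
  move=> [_ c0 a_gt0 y_lt d_ge]; case: eqP => [dE|/eqP d_neq].
    exact: minimal_measure_boundary.
  have /andP[_ y_lt1] := y_lt.
  by apply: minimal_measure_interior => //; rewrite lt_neqAle eq_sym d_neq.
split; [split=> [[mu [rep_mu _] _]|[/case1|/case2] [mu min_mu muP]] | split].
- have psdM := psdmx_moment_matrix rep_mu.
  have c0 := representing_cube bt br hnorm rep_mu.
  have [y_lt1 d_ge] := representing_bound bt br hnorm rep_mu a0.
  have [y0|y0] := eqVneq (beta [:: lY]) 0; [by left|right].
  split=> //; last by rewrite normr_gt0 y0.
  by rewrite lt0r (representing_sqr_ge0 rep_mu) andbT; apply/eqP.
- by exists mu => //; rewrite (muP mu min_mu).1.
- by exists mu => //; rewrite (muP mu min_mu).1; case: ifP.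
- move=> /case1[mu min_mu muP]; split; last by move=> nu /muP[].
  by exists mu => // nu /muP[].
- move=> /case2[mu min_mu muP]; split; first by exists mu => // nu /muP[].
  by move=> nu /muP[-> _]; case: eqP => [dE|d_neq]; split.
Qed.
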